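(* Let $p$ be an odd prime. Define the following Rota--Baxter operators on $E_3$ by their values on $b^sa^tc^r$, $0\le s,t,r\le p-1$: \begin{itemize} \item $\mathfrak{B}^1(b^sa^tc^r)=c^{t}$; \item $\mathfrak{B}^2_x(b^sa^tc^r)=c^{x(t+s)}$, for $0\le x\le p-1$; \item $\mathfrak{B}^3_x(b^sa^tc^r)=b^{-t-s}a^{t+s}c^{xt-ts-\frac{t(t-1)}{2}-\frac{s(s-1)}{2}}$, for $0\le x\le p-1$; \item $\mathfrak{B}^4_{l,y}(b^sa^tc^r)=b^{-lt}a^{lt}c^{ys-l^2\frac{t(t-1)}{2}}$, for $1\le l\le p-1$, $0\le y\le p-1$. \end{itemize} Then any Rota--Baxter operator on $E_3$ is, up to conjugation by automorphisms of $E_3$ and the action $\widetilde{\ }$, equal to one of the operators $\mathfrak{B}^1$, $\mathfrak{B}^2_x$, $\mathfrak{B}^3_x$, $\mathfrak{B}^4_{l,y}$. Moreover, these operators (for all the indicated parameter values) lie in pairwise different orbits.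
   Context: Convention: $[g,h]=g^{-1}h^{-1}gh$. The group $E_3$ is $E_3=\langle a,b,c\mid [a,b]=c,\ a^p=b^p=c,\ [a,c]=[b,c]=c^p=e\rangle$, of order $p^3$; every element is uniquely of the form $b^sa^tc^r$ with $0\le s,t,r\le p-1$. A Rota--Baxter operator on a group $G$ is a map $B\colon G\to G$ such that $B(g)B(h)=B\big(gB(g)hB(g)^{-1}\big)$ for all $g,h\in G$. If $B$ is a Rota--Baxter operator on $G$, then so are $\widetilde B$, where $\widetilde B(g)=g^{-1}B(g^{-1})$, and $\varphi^{-1}\circ B\circ\varphi$ for every $\varphi\in\mathrm{Aut}(G)$. ''Up to conjugation and the action $\widetilde{\ }$'' and ''orbit'' refer to the equivalence relation on the set of Rota--Baxter operators generated by $B\sim\varphi^{-1}\circ B\circ\varphi$ ($\varphi\in \mathrm{Aut}(G)$) and $B\sim\widetilde B$. *)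

(* Defs.v *)
From mathcomp Require Import all_boot all_order all_algebra all_fingroup.
From Stdlib Require Import Relations.

Set Implicit Arguments.
Unset Strict Implicit.
Unset Printing Implicit Defensive.

Local Open Scope group_scope.

(* The commutator of MathComp is [~ x, y] = x^-1 * y^-1 * x * y. *)

(* gT is the group presented by E_3, and a, b, c are its named generators:
   the first clause determines gT up to isomorphism only, so the others say
   that a, b, c themselves generate gT and satisfy the relations. *)
Definition is_E3 (p : nat) (gT : finGroupType) (a b c : gT) : Prop :=
  [/\ [set: gT] \isog Grp (x : y : z :
        [~ x, y] = z, x ^+ p = y ^+ p = z, [~ x, z] = [~ y, z] = 1, z ^+ p = 1),
      <<[set a; b; c]>> = [set: gT],
      [~ a, b] = c,
      a ^+ p = c /\ b ^+ p = c
    & [/\ [~ a, c] = 1, [~ b, c] = 1 & c ^+ p = 1]].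

Definition expgz (gT : finGroupType) (g : gT) (k : int) : gT :=
  match k with Posz n => g ^+ n | Negz n => g ^- n.+1 end.

Definition rota_baxter (gT : finGroupType) (B : {ffun gT -> gT}) : Prop :=
  forall g h : gT, B g * B h = B (g * B g * h * (B g)^-1).

Definition rb_tilde (gT : finGroupType) (B : {ffun gT -> gT}) :
    {ffun gT -> gT} :=
  [ffun g => g^-1 * B g^-1].

Definition rb_conj (gT : finGroupType) (phi : {perm gT})
    (B : {ffun gT -> gT}) : {ffun gT -> gT} :=
  [ffun g => (phi^-1)%g (B (phi g))].

Definition rb_step (gT : finGroupType) (B B' : {ffun gT -> gT}) : Prop :=
  [/\ rota_baxter B, rota_baxter B'
    & (exists2 phi : {perm gT}, phi \in Aut [set: gT] & B' = rb_conj phi B)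
      \/ B' = rb_tilde B].

Definition rb_equiv (gT : finGroupType) : relation {ffun gT -> gT} :=
  clos_refl_sym_trans _ (@rb_step gT).

(* The map sending b^s a^t c^r to F s t r, for 0 <= s, t, r < p.  In E_3 this
   normal form exists and is unique, so that the choice made by pick and the
   default value are both immaterial. *)
Definition on_normal_form (p : nat) (gT : finGroupType) (a b c : gT)
    (F : nat -> nat -> nat -> gT) : {ffun gT -> gT} :=
  [ffun g =>
    if [pick u : 'I_p * 'I_p * 'I_p |
          b ^+ u.1.1 * a ^+ u.1.2 * c ^+ u.2 == g] is Some u
    then F u.1.1 u.1.2 u.2 else 1].

Inductive rb_index : Type :=
  | RB1
  | RB2 (x : nat)
  | RB3 (x : nat)
  | RB4 (l y : nat).

Definition admissible (p : nat) (i : rb_index) : bool :=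
  match i with
  | RB1 => true
  | RB2 x => x <= p - 1
  | RB3 x => x <= p - 1
  | RB4 l y => (1 <= l <= p - 1) && (y <= p - 1)
  end.

(* n (n - 1) / 2; truncation is harmless, as the product is even and is 0 for
   n = 0. *)
Definition tri (n : nat) : nat := (n * (n - 1)) %/ 2.

Definition frakB (p : nat) (gT : finGroupType) (a b c : gT) (i : rb_index) :
    {ffun gT -> gT} :=
  on_normal_form p a b c (fun s t r =>
    match i with
    | RB1 => c ^+ t
    | RB2 x => c ^+ (x * (t + s))
    | RB3 x =>
        expgz b (- t%:Z - s%:Z)%R * a ^+ (t + s)
        * expgz c ((x * t)%:Z - (t * s)%:Z - (tri t)%:Z - (tri s)%:Z)%R
    | RB4 l y =>
        expgz b (- (l * t)%:Z)%R * a ^+ (l * t)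
        * expgz c ((y * s)%:Z - (l ^ 2 * tri t)%:Z)%R
    end).

(* Main.v *)
Require Import Defs.
From mathcomp Require Import all_boot all_order all_algebra all_fingroup.
From mathcomp Require Import all_solvable.
From mathcomp Require Import ring.
From Stdlib Require Import Relations.

Set Implicit Arguments.
Unset Strict Implicit.
Unset Printing Implicit Defensive.

Import GRing.Theory.
Local Open Scope group_scope.

(* Put z = b^-1 a, so that z^p = 1, [z, a] = c and every element is
   a^i z^j c^k; let N, K : E_3 -> F_p (acoord and zcoord below) be the
   homomorphisms reading off i and j.
   A Rota-Baxter operator B satisfies B(c) = c^m, and it multiplies N by m.
   Comparing B(z)B(a) with B(a)B(z) gives m(m+1) = 0.  The tilde action swaps
   m = 0 and m = -1, and for m = 0 the operator B is a homomorphism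
     g |-> z^(ma N + mz K) c^(na N + nz K)
   into the abelian subgroup <z, c>; conversely every such homomorphism is a
   Rota-Baxter operator.  Automorphisms are a |-> a^d z^e c^*, z |-> z c^j, and
   under their action mz and ma nz - mz na are invariant, as are the vanishing
   of ma when mz = 0, the vanishing of nz when ma = mz = 0, and the value of na
   when ma = mz = nz = 0.  The listed operators are representatives. *)

(* The modular group of order p^3 with generators x, y satisfies the relations
   of E_3 for a := x, b := x y, and is not abelian. *)
Lemma E3_c_neq1 (p : nat) (gT : finGroupType) (a b c : gT) :
  prime p -> odd p -> is_E3 p a b c -> c != 1.
Proof.
move=> p_pr p_odd [isoG genG abc [ap bp] [ac bc cp]]; apply/eqP=> c1.
have p_gt1 := prime_gt1 p_pr.
(* If [c] were trivial, the three generators would commute pairwise. *)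
have abG : abelian [set: gT].
  rewrite -genG abelian_gen; apply/centsP=> u + v; rewrite c1 !inE.
  have ab : commute a b by apply/commgP; rewrite abc c1.
  by move=> /orP[/orP[]|] /eqP -> /orP[/orP[]|] /eqP ->;
    rewrite /commute ?mulg1 ?mul1g.
have pM := Grp_modular_group p_pr (isT : 2 < 3).
have oM : #|'Mod_(p ^ 3)| = (p ^ 3)%N by apply: card_modular_group.
have /existsP[[x y] /= /eqP[defM xq yp xy]] := isoGrp_hom pM.
have cM : [~ x, x * y] = x ^+ p.
  by rewrite commgMJ commgg conj1g mulg1 commgEl xy expgS mulKg.
have cx : commute (x ^+ p) x by apply/commute_sym/commuteX.
have xpp : (x ^+ p) ^+ p = 1 by rewrite -expgM -xq mulnn.
have cy : commute (x ^+ p) y.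
  apply/commgP; rewrite commgEl conjXg xy -expgM mulSn expgD expgM xpp.
  by rewrite mulg1 mulVg.
have yxp : [~ y, x] = x ^- p.
  by rewrite -[LHS]invgK invg_comm commgEl xy expgS mulKg.
(* The triple [(x, x * y, x ^+ p)] satisfies the relations of [E_3] and generates; oddness of [p]
   kills the commutator factor in [(x * y) ^+ p]. *)
have homM : [set: 'Mod_(p ^ 3)] \homg [set: gT].
  rewrite isoG; apply/existsP; exists (x, x * y, x ^+ p) => /=.
  apply/eqP; rewrite /= cM; congr (_, _).
    apply/eqP; rewrite eqEsubset subsetT -defM !join_subG !cycle_subG.
    set H := (_ <*> _)%G; have Hx : x \in H by rewrite !mem_gen // !inE mem_gen
      // inE cycle_id.
    have Hxy : x * y \in H.
      by rewrite !mem_gen // inE mem_gen // !inE cycle_id orbT.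
    by rewrite Hx -(mulKg x y) groupM ?groupV.
  have -> : (x * y) ^+ p = x ^+ p.
    rewrite expMg_Rmul ?yxp ?yp ?mulg1; try by apply/commuteV/commute_sym.
    by rewrite bin2odd // expgVn expgM xpp expg1n invg1 mulg1.
  have cxy : commute (x * y) (x ^+ p) by apply: commute_sym; apply: commuteM.
  by move/commute_sym/commgP/eqP: cx => ->; move/commgP/eqP: cxy => ->; rewrite
    xpp.
(* As an image of an abelian group the modular group would be abelian, so [x ^+ p], being a
   commutator, would vanish and leave at most [p * p] elements. *)
have abM : abelian [set: 'Mod_(p ^ 3)].
  by case/homgP: homM => f <-; apply: morphim_abelian.
have xp1 : x ^+ p = 1.
  by rewrite -cM; apply/eqP/commgP/(centsP abM); rewrite inE.
have : (p ^ 3 <= p * p)%N.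
  rewrite -oM -defM norm_joinEr; last first.
    by rewrite cents_norm // (subset_trans _ (subset_trans abM (centS _)))
      ?subsetT.
  apply: leq_trans (_ : #|<[x]>| * #|<[y]>| <= _).
    by rewrite mul_cardG leq_pmulr // cardG_gt0.
  by apply: leq_mul; rewrite -orderE dvdn_leq ?prime_gt0 // order_dvdn ?xp1 ?yp.
by rewrite leqNgt mulnn ltn_exp2l.
Qed.

(** * The tilde action, conjugation and their orbits *)

Lemma rb_tilde_rb (gT : finGroupType) (B : {ffun gT -> gT}) :
  rota_baxter B -> rota_baxter (rb_tilde B).
Proof.
move=> rbB g h; rewrite !ffunE.
(* Inverted, this argument is the one in the Rota-Baxter identity for [g^-1] and [h^-1]. *)
have -> : g * (g^-1 * B g^-1) * h * (g^-1 * B g^-1)^-1 =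
          (g^-1 * B g^-1 * h^-1 * (B g^-1)^-1)^-1.
  by rewrite !invMg !invgK !mulgA mulgV mul1g.
by rewrite invgK -rbB !mulgA mulgKV.
Qed.

Lemma autM (gT : finGroupType) (phi : {perm gT}) : phi \in Aut [set: gT] ->
  {morph phi : g h / g * h}.
Proof. by move=> Aphi g h; apply: (morphicP (Aut_morphic Aphi)); rewrite inE.
  Qed.

Lemma rb_tildeK (gT : finGroupType) : involutive (@rb_tilde gT).
Proof. by move=> B; apply/ffunP=> g; rewrite !ffunE invgK mulKg. Qed.

Lemma rb_tilde_conj (gT : finGroupType) (phi : {perm gT}) (B : {ffun gT -> gT})
  :
  phi \in Aut [set: gT] -> rb_tilde (rb_conj phi B) = rb_conj phi (rb_tilde B).
Proof.
move=> Aphi; have M := autM Aphi; apply/ffunP=> g; rewrite !ffunE.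
have phi1 : phi 1 = 1 by apply: (mulgI (phi 1)); rewrite -M !mulg1.
have V : phi g^-1 = (phi g)^-1.
  by apply: (mulgI (phi g)); rewrite -M !mulgV phi1.
by apply: (@perm_inj _ phi); rewrite M !permKV V.
Qed.

Lemma rb_conj1 (gT : finGroupType) (B : {ffun gT -> gT}) : rb_conj 1 B = B.
Proof. by apply/ffunP=> g; rewrite ffunE invg1 !perm1. Qed.

Lemma rb_conjM (gT : finGroupType) (phi psi : {perm gT}) (B : {ffun gT -> gT}) :
  rb_conj psi (rb_conj phi B) = rb_conj (psi * phi) B.
Proof. by apply/ffunP=> g; rewrite !ffunE invMg !permM. Qed.

(* The tilde action is an involution commuting with conjugation. *)
Lemma rb_equiv_orbit (gT : finGroupType) (B B' : {ffun gT -> gT}) :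
  rb_equiv B B' -> exists2 phi : {perm gT}, phi \in Aut [set: gT] &
    B' = rb_conj phi B \/ B' = rb_tilde (rb_conj phi B).
Proof.
elim=> {B B'} [B B' [_ _ [[phi Aphi ->]|->]]|B|B B' _|B1 B2 B3 _].
- by exists phi => //; left.
- by exists 1; rewrite ?group1 // rb_conj1; right.
- by exists 1; rewrite ?group1 // rb_conj1; left.
- case=> phi Aphi BE; exists phi^-1; rewrite ?groupV //.
  case: BE => ->; [left | right; rewrite -rb_tilde_conj ?groupV //].
    by rewrite rb_conjM mulVg rb_conj1.
  by rewrite rb_tildeK rb_conjM mulVg rb_conj1.
case=> phi Aphi BE _ [psi Apsi B3E]; exists (psi * phi); first exact: groupM.
rewrite -rb_conjM.
case: B3E BE => -> [] ->; rewrite -?rb_tilde_conj ?rb_tildeK //; tauto.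
Qed.

(** * Powers with exponents in the prime field *)

Section PrimeExponent.

Variables (p : nat) (gT : finGroupType).
Hypothesis p_pr : prime p.
Implicit Types (g h : gT) (x y : 'F_p).

Lemma expFp_nat g n : g ^+ p = 1 -> g ^+ (n%:R%R : 'F_p) = g ^+ n.
Proof. by move=> gp; rewrite val_Fp_nat // expg_mod. Qed.

Lemma expFpD g x y : g ^+ p = 1 -> g ^+ (x + y)%R = g ^+ x * g ^+ y.
Proof.
by move=> gp; rewrite -{1}(natr_Zp x) -{1}(natr_Zp y) -natrD expFp_nat // expgD.
Qed.

Lemma expFpN g x : g ^+ p = 1 -> g ^+ (- x)%R = (g ^+ x)^-1.
Proof.
by move=> gp; apply: (mulgI (g ^+ x)); rewrite -expFpD // addrN mulgV.
Qed.

Lemma expFpM g x y : g ^+ p = 1 -> g ^+ (x * y)%R = g ^+ x ^+ y.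
Proof.
by move=> gp; rewrite -{1}(natr_Zp x) -{1}(natr_Zp y) -natrM expFp_nat // expgM.
Qed.

Lemma expFp_inj g : g ^+ p = 1 -> g != 1 -> injective (fun x : 'F_p => g ^+ x).
Proof.
move=> gp g1 x y /eqP; have og : #[g] = p by apply: nt_prime_order.
rewrite eq_expg_mod_order og => /eqP xy.
by rewrite -(natr_Zp x) -(natr_Zp y) -(Fp_nat_mod p_pr x) xy Fp_nat_mod.
Qed.

End PrimeExponent.

(** * Coordinates on the group modulo [<[c]>] *)

Section Coordinates.

Variables (p : nat) (gT : finGroupType) (a z c : gT).
Hypotheses (p_pr : prime p) (p_odd : odd p).
Hypotheses (c1 : c != 1) (cp : c ^+ p = 1) (zp : z ^+ p = 1) (ap : a ^+ p = c).
Hypotheses (cza : [~ z, a] = c) (cC : forall g, commute c g).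
Hypothesis genG : <<[set a; z]>> = [set: gT].

Local Notation F := 'F_p.
Implicit Types (g h : gT) (n m : nat).

Lemma two_neq0 : (2%:R != 0 :> F)%R.
Proof.
rewrite -(dvdn_pcharf (pchar_Fp p_pr)); apply/negP=> /dvdn_leq => /(_ isT) p2.
have : p = 2 by apply/eqP; rewrite eqn_leq p2 prime_gt1.
by move=> pE; move: p_odd; rewrite pE.
Qed.

(** The subgroup [<[a]>] contains [c] and is normalised by [z], so the join of the two cycles is
    their product. *)
Lemma normal_form g : exists n m, g = a ^+ n * z ^+ m.
Proof.
have gG : g \in <<[set a; z]>> by rewrite genG inE.
rewrite -joingE -joing_idl -joing_idr -/(cycle a) -/(cycle z) in gG.
(* The exponent encodes [a * c^-1], because [c^-1] is [c ^+ p.-1] and [c] is [a ^+ p]. *)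
have az : a ^ z = a ^+ (1 + p * p.-1).
  rewrite conjg_mulR -[[~ a, z]]invgK invg_comm cza expgD expg1 expgM ap.
  by congr (_ * _); apply: (mulgI c); rewrite mulgV -expgS prednK ?prime_gt0.
rewrite norm_joinEr ?norms_cycle ?az ?mem_cycle // in gG.
case/mulsgP: gG => _ _ /cycleP[n ->] /cycleP[m ->] ->; by exists n, m.
Qed.

(** Induction without an inverse case: the normal form uses only natural powers. *)
Lemma gen_ind (P : gT -> Prop) : P 1 -> P a -> P z ->
  (forall g h, P g -> P h -> P (g * h)) -> forall g, P g.
Proof.
move=> P1 Pa Pz PM g; have [n [m ->]] := normal_form g.
have PX x k : P x -> P (x ^+ k).
  by move=> Px; elim: k => // k IHk; rewrite expgS; apply: PM.
by apply: PM; apply: PX.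
Qed.

Lemma centC x : x \in <[c]> -> forall g, commute x g.
Proof. by case/cycleP=> k -> g; apply/commute_sym/commuteX/commute_sym. Qed.

Lemma conjC x g : x \in <[c]> -> x ^ g = x.
Proof. by move=> xc; rewrite conjgE (centC xc) mulKg. Qed.

(** Central values make commutators multiplicative in each argument, so it suffices to check
    generators, first on the left and then on the right. *)
Lemma comm_mem g h : [~ g, h] \in <[c]>.
Proof.
have ga : forall x, [~ x, a] \in <[c]>.
  apply: gen_ind; rewrite ?comm1g ?commgg ?cza ?group1 ?cycle_id //.
  by move=> x y xa ya; rewrite commMgJ groupM // conjC.
have gz : forall x, [~ x, z] \in <[c]>.
  apply: gen_ind; rewrite ?comm1g ?commgg ?group1 ?cycle_id //.
    by rewrite -groupV invg_comm cza cycle_id.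
  by move=> x y xa ya; rewrite commMgJ groupM // conjC.
move: h; apply: gen_ind => // [|x y gx gy]; first by rewrite commg1 group1.
by rewrite commgMJ groupM // conjC.
Qed.

Lemma exp_c_mem (x : F) : c ^+ x \in <[c]>.
Proof. exact: mem_cycle. Qed.

(** Discrete logarithm to base [c]; outside [<[c]>] the value is a mere default. *)
Definition clog g : F := odflt 0%R [pick x : F | c ^+ x == g].

Lemma clogK g : g \in <[c]> -> c ^+ clog g = g.
Proof.
case/cycleP=> k ->; rewrite /clog; case: pickP => [x /eqP //|].
by move/(_ k%:R%R); rewrite expFp_nat // eqxx.
Qed.

Lemma clogX (x : F) : clog (c ^+ x) = x.
Proof. by apply: (expFp_inj p_pr cp c1) => /=; rewrite clogK ?exp_c_mem. Qed.

Lemma clogM g h : g \in <[c]> -> h \in <[c]> ->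
  clog (g * h) = (clog g + clog h)%R.
Proof.
move=> gc hc; apply: (expFp_inj p_pr cp c1) => /=.
by rewrite expFpD // !clogK // groupM.
Qed.

Lemma clog1 : clog 1 = 0%R.
Proof. exact: (clogX 0%R). Qed.

Lemma clogc : clog c = 1%R.
Proof. by have := clogX 1%R; rewrite (expFp_nat p_pr 1%N cp) expg1. Qed.

Lemma expXM g h n : (g * h) ^+ n = g ^+ n * h ^+ n * [~ h, g] ^+ 'C(n, 2)%N.
Proof. by rewrite expMg_Rmul //; apply: commute_sym; apply: centC; apply:
  comm_mem. Qed.

(** For odd [p] the binomial ['C(p, 2)] is a multiple of [p], which kills the central correction. *)
Lemma exp_pM g h : (g * h) ^+ p = g ^+ p * h ^+ p.
Proof.
rewrite expXM bin2odd // expgM; have /cycleP[k ->] := comm_mem h g.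
by rewrite -(expgM c) mulnC expgM cp !expg1n mulg1.
Qed.

Lemma exp_p_mem g : g ^+ p \in <[c]>.
Proof.
move: g; apply: gen_ind; rewrite ?expg1n ?ap ?zp ?group1 ?cycle_id //.
by move=> g h gc hc; rewrite exp_pM groupM.
Qed.

(* For g = a^i z^j c^k these are the residues of i and j. *)
Definition acoord g : F := clog (g ^+ p).
Definition zcoord g : F := clog [~ g, a].

Lemma acoordM g h : acoord (g * h) = (acoord g + acoord h)%R.
Proof. by rewrite /acoord exp_pM clogM ?exp_p_mem. Qed.

Lemma zcoordM g h : zcoord (g * h) = (zcoord g + zcoord h)%R.
Proof. by rewrite /zcoord commMgJ conjC ?comm_mem // clogM ?comm_mem. Qed.

Lemma acoord_a : acoord a = 1%R. Proof. by rewrite /acoord ap clogc. Qed.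
Lemma acoord_z : acoord z = 0%R. Proof. by rewrite /acoord zp clog1. Qed.
Lemma zcoord_a : zcoord a = 0%R. Proof. by rewrite /zcoord commgg clog1. Qed.
Lemma zcoord_z : zcoord z = 1%R. Proof. by rewrite /zcoord cza clogc. Qed.

Section Additive.

Variable f : gT -> F.
Hypothesis fM : forall g h, f (g * h) = (f g + f h)%R.

Lemma add_1 : f 1 = 0%R.
Proof. by apply: (addrI (f 1)); rewrite -fM mulg1 addr0. Qed.

Lemma add_X g n : f (g ^+ n) = (n%:R * f g)%R.
Proof.
elim: n => [|n IHn]; first by rewrite add_1 mul0r.
by rewrite expgS fM IHn -[n.+1]addn1 natrD mulrDl mul1r addrC.
Qed.

Lemma add_V g : f g^-1 = (- f g)%R.
Proof. by apply: (addrI (f g)); rewrite -fM mulgV add_1 addrN. Qed.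

End Additive.

Lemma acoordX g n : acoord (g ^+ n) = (n%:R * acoord g)%R.
Proof. exact: (add_X acoordM). Qed.
Lemma zcoordX g n : zcoord (g ^+ n) = (n%:R * zcoord g)%R.
Proof. exact: (add_X zcoordM). Qed.
Lemma acoordV g : acoord g^-1 = (- acoord g)%R.
Proof. exact: (add_V acoordM). Qed.
Lemma zcoordV g : zcoord g^-1 = (- zcoord g)%R.
Proof. exact: (add_V zcoordM). Qed.
Lemma acoord1 : acoord 1 = 0%R. Proof. exact: (add_1 acoordM). Qed.
Lemma zcoord1 : zcoord 1 = 0%R. Proof. exact: (add_1 zcoordM). Qed.

(** A homomorphism to the prime field is known from its values at the generators [a] and [z]. *)
Lemma additiveE (f : gT -> F) (fM : forall g h, f (g * h) = (f g + f h)%R) g :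
  f g = (acoord g * f a + zcoord g * f z)%R.
Proof.
move: g; apply: gen_ind; rewrite ?acoord1 ?zcoord1 ?(add_1 fM) ?acoord_a
  ?zcoord_a ?acoord_z ?zcoord_z.
- by ring.
- by ring.
- by ring.
- by move=> g h; rewrite fM acoordM zcoordM => -> ->; ring.
Qed.

Lemma acoord_c : acoord c = 0%R. Proof. by rewrite /acoord cp clog1. Qed.
Lemma zcoord_c : zcoord c = 0%R.
Proof. by have /commgP/eqP ca := cC a; rewrite /zcoord ca clog1. Qed.

Lemma acoord_cX (x : F) : acoord (c ^+ x) = 0%R.
Proof. by rewrite acoordX acoord_c mulr0. Qed.
Lemma zcoord_cX (x : F) : zcoord (c ^+ x) = 0%R.
Proof. by rewrite zcoordX zcoord_c mulr0. Qed.
Lemma acoord_zX (x : F) : acoord (z ^+ x) = 0%R.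
Proof. by rewrite acoordX acoord_z mulr0. Qed.
Lemma zcoord_zX (x : F) : zcoord (z ^+ x) = x.
Proof. by rewrite zcoordX zcoord_z mulr1 natr_Zp. Qed.
(** The determinant form on the plane of coordinates, which is the commutator pairing of the
    group. *)
Definition omega g h : F := (zcoord g * acoord h - acoord g * zcoord h)%R.

(** The logarithm of the commutator is additive in each variable, so its values on [a] and [z]
    determine it. *)
Lemma commE g h : [~ g, h] = c ^+ omega g h.
Proof.
rewrite -(clogK (comm_mem g h)); congr (_ ^+ nat_of_ord _).
rewrite (@additiveE (fun g => clog [~ g, h])); last first.
  by move=> x y; rewrite commMgJ conjC ?comm_mem // clogM ?comm_mem.
have cM x : forall g h, clog [~ x, g * h] = (clog [~ x, g] + clog [~ x, h])%R.
  move=> u v; rewrite commgMJ conjC ?comm_mem // clogM ?comm_mem //.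
  by rewrite addrC.
rewrite (additiveE (cM a)) (additiveE (cM z)) !commgg !clog1 cza clogc.
have -> : [~ a, z] = c ^+ (-1 : F)%R.
  by rewrite -[LHS]invgK invg_comm cza expFpN // (@expFp_nat p gT p_pr c 1%N
    cp).
by rewrite clogX /omega; ring.
Qed.

Lemma expXE g h n :
  (g * h) ^+ n = g ^+ n * h ^+ n * c ^+ (omega h g * 'C(n, 2)%:R)%R.
Proof.
by rewrite expXM commE expFpM // expFp_nat // -expgM mulnC expgM cp expg1n.
Qed.

Lemma swap g h : g * h = h * g * c ^+ omega g h.
Proof. by rewrite commgC commE. Qed.

(** In [a ^+ n * z ^+ m] both exponents are multiples of [p], which leaves a power of
    [a ^+ p = c]. *)
Lemma kernel_mem g : acoord g = 0%R -> zcoord g = 0%R -> g = c ^+ clog g.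
Proof.
have [n [m ->]] := normal_form g.
rewrite acoordM zcoordM !acoordX !zcoordX acoord_a acoord_z zcoord_a zcoord_z
  !mulr0 !mulr1 addr0 add0r => n0 m0.
rewrite -(expFp_nat p_pr m zp) m0 mulg1.
have : p %| n by rewrite (dvdn_pcharf (pchar_Fp p_pr)) n0.
case/dvdnP=> k ->; rewrite mulnC expgM ap.
by rewrite clogK ?mem_cycle.
Qed.

Lemma coord_eq g h : acoord g = acoord h -> zcoord g = zcoord h -> exists x :
  F, g = h * c ^+ x.
Proof.
move=> Ngh Kgh; exists (clog (h^-1 * g)); rewrite -kernel_mem ?mulKVg //.
  by rewrite acoordM acoordV Ngh addNr.
by rewrite zcoordM zcoordV Kgh addNr.
Qed.

Lemma conjV_omega g h : g * h * g^-1 = h * c ^+ omega g h.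
Proof. by rewrite (swap g h) -!mulgA (centC (exp_c_mem _)) mulKVg. Qed.

(** * Rota-Baxter operators and the residue [m] *)

Section RotaBaxter.

Variable B : {ffun gT -> gT}.
Hypothesis rbB : rota_baxter B.

Lemma rb_1 : B 1 = 1.
Proof.
by apply: (mulgI (B 1)); rewrite rbB mul1g !mulg1 mulgV.
Qed.

(** Conjugating [h] changes it only by a central factor, so [B] is multiplicative up to a twist by a
    power of [c]. *)
Lemma rb_omega g h : B g * B h = B (g * h * c ^+ omega (B g) h).
Proof. by rewrite rbB -!mulgA [B g * _]mulgA conjV_omega. Qed.

Lemma rb_mulc g n : B (g * c ^+ n) = B g * B c ^+ n.
Proof.
elim: n => [|n IHn]; first by rewrite !mulg1.
rewrite !expgSr !mulgA -IHn rb_omega /omega acoord_c zcoord_c !mulr0 subr0.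
by rewrite mulg1.
Qed.

Lemma rb_cX n : B (c ^+ n) = B c ^+ n.
Proof. by rewrite -[c ^+ n]mul1g rb_mulc rb_1 mul1g. Qed.

Lemma rb_cp : B c ^+ p = 1. Proof. by rewrite -rb_cX cp rb_1. Qed.

Lemma rb_c : exists m : F, B c = c ^+ m.
Proof.
have NBc : acoord (B c) = 0%R by rewrite /acoord rb_cp clog1.
have wE : omega (B c) a = zcoord (B c) by rewrite /omega acoord_a NBc; ring.
(* After cancelling [B a * B c], a power of [c] equals [B c] raised to its own [zcoord]; taking
   [zcoord] shows that this residue has square zero. *)
have := rb_omega c a; rewrite wE (swap (B c)) (cC a) rb_mulc (rb_mulc a 1).
move/mulgI/(congr1 zcoord); rewrite zcoord_cX zcoordX natr_Zp.
move=> /esym/eqP; rewrite mulf_eq0 orbb => /eqP KBc.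
by exists (clog (B c)); rewrite -kernel_mem.
Qed.

Lemma rb_dichotomy : exists m : F,
  [/\ B c = c ^+ m, (m * (m + 1) = 0)%R & forall g, acoord (B g) = (m * acoord
    g)%R].
Proof.
have [m Bc] := rb_c.
(* The twist is central, so both coordinates of [B] are additive. *)
have BM g h : B g * B h = B (g * h) * c ^+ (m * omega (B g) h)%R.
  by rewrite rb_omega rb_mulc Bc -expFpM.
have NBM g h : acoord (B (g * h)) = (acoord (B g) + acoord (B h))%R.
  by rewrite -acoordM BM acoordM acoord_cX addr0.
have KBM g h : zcoord (B (g * h)) = (zcoord (B g) + zcoord (B h))%R.
  by rewrite -zcoordM BM zcoordM zcoord_cX addr0.
have BX g n : B g ^+ n = B (g ^+ n) * c ^+ (m * omega (B g) g * 'C(n, 2)%:R)%R.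
  elim: n => [|n IHn]; first by rewrite rb_1 mulr0 mulg1.
  rewrite !expgSr IHn -mulgA (centC (exp_c_mem _)) mulgA BM -mulgA.
  have -> : omega (B (g ^+ n)) g = (n%:R * omega (B g) g)%R.
    have NBX := @add_X (fun x => acoord (B x)) NBM g n.
    have KBX := @add_X (fun x => zcoord (B x)) KBM g n.
    by rewrite /omega NBX KBX; ring.
  by rewrite -expFpD // binS bin1 natrD; congr (_ * c ^+ nat_of_ord _); ring.
(* In the power formula at exponent [p] the twist vanishes, so [B g ^+ p] is [B (g ^+ p)], where
   [g ^+ p] is a power of [c]. *)
have NB g : acoord (B g) = (m * acoord g)%R.
  rewrite /acoord BX bin2odd // natrM (pchar_Fp_0 p_pr) mul0r mulr0 mulg1.
  by rewrite -(clogK (exp_p_mem g)) rb_cX Bc -expFpM // !clogX.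
exists m; split=> //.
have NBa : acoord (B a) = m by rewrite NB acoord_a mulr1.
have NBz : acoord (B z) = 0%R by rewrite NB acoord_z mulr0.
(* In the exponents of [c] the unknown [zcoord (B z)] cancels, leaving [m + m^2 = 0]. *)
have := swap (B z) (B a); rewrite !BM (swap z a) rb_mulc Bc -!mulgA.
move/mulgI; rewrite -expFpM // -!expFpD // => /(congr1 clog); rewrite !clogX.
rewrite /omega acoord_a acoord_z zcoord_a zcoord_z NBa NBz => E.
suff : (m * (m + 1) = (m * (1 * 1 - 0 * 0) + m * (zcoord (B z) * 1 - 0 * 0)) -
  (m * (zcoord (B a) * 0 - m * 1) + (zcoord (B z) * m - 0 * zcoord (B a))))%R.
  by rewrite E; rewrite addrN.
by ring.
Qed.

End RotaBaxter.

(** * Homomorphisms into the abelian subgroup generated by [z] and [c] *)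

Lemma zc_mul (u x v y : F) :
  z ^+ u * c ^+ x * (z ^+ v * c ^+ y) = z ^+ (u + v)%R * c ^+ (x + y)%R.
Proof.
rewrite -mulgA (mulgA (c ^+ x)) (centC (exp_c_mem x)) -mulgA -expFpD //.
by rewrite mulgA -expFpD.
Qed.

Definition zc_hom (ma mz na nz : F) : {ffun gT -> gT} :=
  [ffun g => z ^+ (ma * acoord g + mz * zcoord g)%R * c ^+ (na * acoord g + nz
    * zcoord g)%R].

Lemma zc_homM ma mz na nz g h :
  zc_hom ma mz na nz (g * h) = zc_hom ma mz na nz g * zc_hom ma mz na nz h.
Proof.
rewrite !ffunE acoordM zcoordM zc_mul.
by congr (_ * _); congr (_ ^+ nat_of_ord _); ring.
Qed.

(** These homomorphisms kill [c], hence do not see the conjugation of [h]. *)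
Lemma zc_hom_rb ma mz na nz : rota_baxter (zc_hom ma mz na nz).
Proof.
move=> g h; rewrite -zc_homM; set x := zc_hom _ _ _ _ g; rewrite !ffunE.
by rewrite -!mulgA (mulgA x) conjV_omega !acoordM !zcoordM acoord_cX zcoord_cX
  !addr0.
Qed.

(** Here [m = 0], so the twist disappears, [B] is a homomorphism and its image has zero [acoord]. *)
Lemma rb_zc_hom (B : {ffun gT -> gT}) : rota_baxter B -> B c = 1 ->
  exists ma mz na nz, B = zc_hom ma mz na nz.
Proof.
move=> rbB Bc; have [m [cm _ NB]] := rb_dichotomy rbB.
have m0 : m = 0%R by rewrite -(clogX m) -cm Bc clog1.
have {m cm m0}NB g : acoord (B g) = 0%R by rewrite NB m0 mul0r.
have BM g h : B (g * h) = B g * B h.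
  by rewrite rb_omega // rb_mulc // Bc expg1n mulg1.
have zc g : acoord g = 0%R -> exists k l : F, g = z ^+ k * c ^+ l.
  move=> Ng; exists (zcoord g); apply: coord_eq; first by rewrite acoord_zX.
  by rewrite zcoord_zX.
have [ma [na Ba]] := zc _ (NB a); have [mz [nz Bz]] := zc _ (NB z).
exists ma, mz, na, nz; apply/ffunP; apply: gen_ind.
- by rewrite rb_1 // ffunE acoord1 zcoord1 !mulr0 addr0 mulg1.
- by rewrite Ba ffunE acoord_a zcoord_a !mulr0 !mulr1 !addr0.
- by rewrite Bz ffunE acoord_z zcoord_z !mulr0 !mulr1 !add0r.
- by move=> g h gB hB; rewrite BM zc_homM gB hB.
Qed.

(** * Automorphisms and their action on the parameters *)

(** The power of [c] in [phi a] is not recorded: conjugating a [zc_hom] by [phi] does not depend on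
    it. *)
Definition aut_params (phi : {perm gT}) (d e j : F) : Prop :=
  [/\ d != 0%R, forall g, acoord (phi g) = (d * acoord g)%R,
      forall g, zcoord (phi g) = (e * acoord g + zcoord g)%R, phi z = z * c ^+ j
    & phi c = c ^+ d].

Lemma autX (phi : {perm gT}) g n : phi \in Aut [set: gT] ->
  phi (g ^+ n) = phi g ^+ n.
Proof.
move/autM=> phiM; elim: n => [|n IHn]; last by rewrite !expgS phiM IHn.
by apply: (mulgI (phi 1)); rewrite -phiM !mulg1.
Qed.

(** Taking [p]-th powers gives [phi c] and the zero [acoord] of [phi z]; the relation [[~ z, a] = c]
    then forces [zcoord (phi z)] to be 1. *)
Lemma aut_has_params (phi : {perm gT}) : phi \in Aut [set: gT] ->
  exists d e j, aut_params phi d e j.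
Proof.
move=> Aphi; have phiM := autM Aphi; have phiX g n := autX g n Aphi.
have phi1 : phi 1 = 1 by rewrite -(expg0 1) phiX.
have phic : phi c = c ^+ acoord (phi a) by rewrite /acoord clogK ?exp_p_mem //
  -phiX ap.
have acoordM' g h : acoord (phi (g * h)) = (acoord (phi g) + acoord (phi h))%R
  by rewrite phiM acoordM.
have zcoordM' g h : zcoord (phi (g * h)) = (zcoord (phi g) + zcoord (phi h))%R
  by rewrite phiM zcoordM.
have NE := @additiveE (fun g => acoord (phi g)) acoordM'.
have KE := @additiveE (fun g => zcoord (phi g)) zcoordM'.
have Npz : acoord (phi z) = 0%R by rewrite /acoord -phiX zp phi1 clog1.
have d0 : acoord (phi a) != 0%R.
  by apply: contra c1 => /eqP d0; rewrite -(inj_eq (@perm_inj _ phi)) phic d0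
    phi1.
have Kpz : zcoord (phi z) = 1%R.
  have E : phi z * phi a = phi a * phi z * phi c by rewrite -!phiM -cza -commgC.
  move: E; rewrite (swap (phi z)) phic => /mulgI/(congr1 clog).
  rewrite !clogX /omega Npz mul0r subr0 => dE; apply: (mulIf d0).
  by rewrite mul1r.
have [j jE] : exists x : F, phi z = z * c ^+ x.
  by apply: coord_eq; rewrite ?acoord_z ?zcoord_z.
exists (acoord (phi a)), (zcoord (phi a)), j; split=> // g.
  by rewrite NE Npz mulr0 addr0 mulrC.
by rewrite KE Kpz mulr1 mulrC.
Qed.

Lemma zc_hom_inj ma mz na nz ma' mz' na' nz' :
  zc_hom ma mz na nz = zc_hom ma' mz' na' nz' -> [/\ ma = ma', mz = mz', na =
    na' & nz = nz'].
Proof.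
have inj (u v u' v' : F) :
    z ^+ u * c ^+ v = z ^+ u' * c ^+ v' -> u = u' /\ v = v'.
  move=> E; have uu : u = u'.
    by move/(congr1 zcoord): E; rewrite !zcoordM !zcoord_zX !zcoord_cX !addr0.
  by split=> //; move: E; rewrite uu => /mulgI/(congr1 clog); rewrite !clogX.
move=> E; have := congr1 (fun f : {ffun gT -> gT} => f a) E.
have := congr1 (fun f : {ffun gT -> gT} => f z) E.
rewrite !ffunE acoord_a acoord_z zcoord_a zcoord_z !mulr0 !mulr1 !addr0 !add0r.
by move=> /inj[-> ->] /inj[-> ->].
Qed.

(** Both sides are compared after applying [phi]. The terms in [j] come from [phi z = z * c ^+ j],
    the division by [d] from [phi c = c ^+ d]. *)
Lemma rb_conj_zc_hom (phi : {perm gT}) d e j ma mz na nz : phi \in Aut [set: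
  gT] ->
  aut_params phi d e j ->
  rb_conj phi (zc_hom ma mz na nz) =
    let ma' := (d * ma + e * mz)%R in
    zc_hom ma' mz ((d * na + e * nz - j * ma') / d)%R ((nz - j * mz) / d)%R.
Proof.
move=> Aphi [d0 Nphi Kphi phiz phic] /=; apply/ffunP=> g; rewrite !ffunE.
apply: (@perm_inj _ phi); rewrite permKV autM // !autX // phiz phic.
rewrite Nphi Kphi expgMn; last exact: commute_sym (centC (exp_c_mem _) z).
rewrite -!expFpM // -mulgA -expFpD //.
by congr (_ * _); congr (_ ^+ nat_of_ord _); field.
Qed.

Lemma two_bin2 n : (2%:R * 'C(n, 2)%:R = n%:R * (n%:R - 1) :> F)%R.
Proof.
rewrite -natrM -mul_bin_diag bin1 natrM; case: n => [|n]; first by rewrite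
  !mul0r.
by rewrite /= -[n.+1]addn1 natrD addrK.
Qed.

Lemma aut_exists (d e j : F) : d != 0%R ->
  exists2 phi : {perm gT}, phi \in Aut [set: gT] & aut_params phi d e j.
Proof.
move=> d0; have two0 := two_neq0.
(* The power [g ^+ d] scales both coordinates by [d]; this exponent of [z] corrects [zcoord] to the
   wanted value. *)
pose zf g : F := (e * acoord g + (1 - d) * zcoord g)%R.
pose b : F := (d * (d - 1) / 2%:R)%R.
have bE : (('C(d, 2))%:R = b :> F)%R.
  by apply: (mulfI two0); rewrite two_bin2 /b natr_Zp; field.
(* The quadratic part compensates the commutators that arise when [f (g * h)] is reordered, [b]
   being ['C(d, 2)] modulo [p]; the linear part produces [j]. *)
pose cf g : F := (d * e * acoord g ^+ 2 / 2%:R - b * acoord g * zcoord g + j *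
  zcoord g)%R.
pose f g := g ^+ d * z ^+ zf g * c ^+ cf g.
have Nf g : acoord (f g) = (d * acoord g)%R.
  by rewrite /f !acoordM acoordX acoord_zX acoord_cX natr_Zp !addr0.
have Kf g : zcoord (f g) = (e * acoord g + zcoord g)%R.
  by rewrite /f !zcoordM zcoordX zcoord_zX zcoord_cX natr_Zp /zf; ring.
have fM : {morph f : g h / g * h}.
  move=> g h; rewrite /f expXE bE -!mulgA; congr (_ * _).
  rewrite !mulgA -(mulgA _ (c ^+ cf g) (h ^+ d)) (centC (exp_c_mem _) (h ^+ d)).
  rewrite !mulgA (swap (z ^+ zf g)) -!mulgA; congr (_ * _).
  rewrite (centC (exp_c_mem _)) -!mulgA -expFpD //.
  rewrite (mulgA (c ^+ omega _ _)) -expFpD // (mulgA (z ^+ zf g)) zc_mul.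
  congr (_ * _); congr (_ ^+ nat_of_ord _).
    by rewrite /zf acoordM zcoordM; ring.
  by rewrite /cf /zf /omega acoord_zX zcoord_zX acoordX zcoordX acoordM zcoordM
    natr_Zp /b; field.
have fc : f c = c ^+ d.
  have zc0 : zf c = 0%R by rewrite /zf acoord_c zcoord_c; ring.
  have cc0 : cf c = 0%R by rewrite /cf acoord_c zcoord_c; ring.
  by rewrite /f zc0 cc0 !mulg1.
have f1 : f 1 = 1 by apply: (mulgI (f 1)); rewrite -fM !mulg1.
have fX g n : f (g ^+ n) = f g ^+ n.
  by elim: n => [|n IHn]; rewrite ?f1 // !expgS fM IHn.
have f_inj : injective f.
  move=> g h fgh.
  have Ngh : acoord g = acoord h by apply: (mulfI d0); rewrite -!Nf fgh.
  have Kgh : zcoord g = zcoord h.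
    by apply: (addrI (e * acoord g)%R); rewrite {2}Ngh -!Kf fgh.
  have [x gE] := coord_eq Ngh Kgh; move: fgh; rewrite gE fM -[RHS]mulg1.
  move/mulgI/(congr1 clog); rewrite fX fc -expFpM // clogX clog1 => /eqP.
  by rewrite mulf_eq0 (negPf d0) /= => /eqP ->; rewrite mulg1.
exists (perm f_inj).
  rewrite inE; apply/andP; split.
    by apply/subsetP=> x; rewrite !inE.
  by apply/morphicP=> x y _ _; rewrite !permE.
split=> // [g|g||]; rewrite permE ?Nf ?Kf //.
have zfz : zf z = (1 - d)%R by rewrite /zf acoord_z zcoord_z; ring.
have cfz : cf z = j by rewrite /cf acoord_z zcoord_z; field.
rewrite /f zfz cfz -expFpD // addrC subrK.
by rewrite (expFp_nat p_pr 1%N zp) expg1.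
Qed.

(** * Residues, integer powers and triangular numbers *)

Lemma bin2_Fp n : ('C(n, 2)%:R = n%:R * (n%:R - 1) / 2%:R :> F)%R.
Proof.
have two0 := two_neq0; apply: (mulfI two0); rewrite two_bin2.
by field.
Qed.

Lemma Fp_lt (x : F) : x < p.
Proof. by rewrite -(natr_Zp x) val_Fp_nat // ltn_pmod ?prime_gt0. Qed.

Lemma Fp_gt0 (x : F) : x != 0%R -> 0 < x.
Proof.
by rewrite lt0n; apply: contraNneq => x0; rewrite -(natr_Zp x) x0.
Qed.

Lemma Fp_nat_inj n m : n < p -> m < p -> (n%:R = m%:R :> F)%R -> n = m.
Proof.
by move=> np mp /(congr1 (@nat_of_ord _)); rewrite !val_Fp_nat // !modn_small.
Qed.

Lemma expgzN g n : expgz g (- n%:Z)%R = g ^- n.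
Proof. by case: n => [|n] //; rewrite /= invg1. Qed.

Lemma expgz_c (k : int) : expgz c k = c ^+ (k%:~R%R : F).
Proof.
case: k => n; first by rewrite /= -(expFp_nat p_pr n cp).
by rewrite [in RHS]NegzE rmorphN expFpN // (expFp_nat p_pr n.+1 cp).
Qed.

Lemma triE n : tri n = 'C(n, 2).
Proof. by rewrite /tri bin2 subn1 divn2. Qed.

(** * The listed operators in coordinates *)

Section NormalForm.

Variable b : gT.
Hypothesis zE : z = b^-1 * a.

Lemma bE : b = a * z^-1. Proof. by rewrite zE invMg invgK mulKVg. Qed.
Lemma acoord_b : acoord b = 1%R.
Proof. by rewrite bE acoordM acoordV acoord_a acoord_z oppr0 addr0. Qed.
Lemma zcoord_b : zcoord b = (-1)%R.
Proof. by rewrite bE zcoordM zcoordV zcoord_a zcoord_z add0r. Qed.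

(** The binomial offsets the commutators collected in expanding [(b^-1 * a) ^+ n]. *)
Lemma bVa_exp n : b ^- n * a ^+ n = z ^+ n * c ^+ 'C(n, 2).
Proof.
rewrite zE expXE /omega acoordV zcoordV acoord_a zcoord_a acoord_b zcoord_b
  expgVn -mulgA.
rewrite -(expFp_nat p_pr 'C(n, 2) cp) -expFpD //.
have -> : ((0 * - 1 - 1 * - -1) * 'C(n, 2)%:R + 'C(n, 2)%:R = 0 :> F)%R by ring.
by rewrite mulg1.
Qed.

(** Substituting [acoord g = s + t] and [zcoord g = - s], the quadratic terms of the listed formulas
    cancel against the binomial of [bVa_exp]. *)
Definition frakB_hom (i : rb_index) : {ffun gT -> gT} :=
  match i with
  | RB1 => zc_hom 0 0 1 1
  | RB2 x => zc_hom 0 0 x%:R 0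
  | RB3 x => zc_hom 1 0 x%:R x%:R
  | RB4 l y => zc_hom l%:R l%:R 'C(l, 2)%:R ('C(l, 2)%:R - y%:R)
  end%R.

Lemma frakBE i : frakB p a b c i = frakB_hom i.
Proof.
have two0 := two_neq0.
apply/ffunP=> g; rewrite ffunE; case: pickP => [[[s t] r] /= /eqP gE|none].
  have Ng : acoord g = ((s : nat)%:R + (t : nat)%:R)%R.
    by rewrite -gE !acoordM !acoordX acoord_b acoord_a acoord_c !mulr1 mulr0
      addr0.
  have Kg : zcoord g = (- (s : nat)%:R)%R.
    by rewrite -gE !zcoordM !zcoordX zcoord_b zcoord_a zcoord_c !mulr0 !addr0
      mulrN1.
  case: i => [|x|x|l y]; rewrite ffunE Ng Kg.
  - rewrite -(expFp_nat p_pr t cp) !mul0r addr0 mul1g.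
    by congr (_ ^+ nat_of_ord _); ring.
  - rewrite -(expFp_nat p_pr (x * _)%N cp) !mul0r addr0 mul1g natrM natrD.
    by congr (_ ^+ nat_of_ord _); ring.
  - rewrite -opprD -PoszD expgzN bVa_exp expgz_c -mulgA.
    rewrite -(expFp_nat p_pr 'C(_, 2) cp) -(expFp_nat p_pr (t + s) zp) -expFpD
      //.
    rewrite !intrB -!pmulrn !natrM !triE !bin2_Fp !natrD.
    by congr (_ * _); congr (_ ^+ nat_of_ord _); field.
  rewrite expgzN bVa_exp expgz_c -mulgA.
  rewrite -(expFp_nat p_pr 'C(_, 2) cp) -(expFp_nat p_pr (l * t) zp) -expFpD //.
  rewrite !intrB -!pmulrn !natrM !triE !bin2_Fp !natrM ?natrX.
  by congr (_ * _); congr (_ ^+ nat_of_ord _); field.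
(* The default branch is impossible: these residues, solved from the coordinates, give a normal form
   of [g]. *)
pose s : F := (- zcoord g)%R; pose t : F := (acoord g + zcoord g)%R.
have [x gE] : exists x : F, g = b ^+ s * a ^+ t * c ^+ x.
  apply: coord_eq; rewrite ?acoordM ?zcoordM ?acoordX ?zcoordX ?acoord_a
    ?zcoord_a ?acoord_b ?zcoord_b !natr_Zp /s /t; ring.
have := none (Ordinal (Fp_lt s), Ordinal (Fp_lt t), Ordinal (Fp_lt x)).
by rewrite /= -gE eqxx.
Qed.

(** * Reduction to the listed operators *)

(** With the divisions by [d] cleared, reaching a target means solving linear equations for [d], [e]
    and [j]. *)
Lemma zc_hom_equiv d e j ma mz na nz ma' na' nz' : d != 0%R ->
  (ma' = d * ma + e * mz)%R -> (d * na' + j * ma' = d * na + e * nz)%R ->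
  (d * nz' + j * mz = nz)%R ->
  rb_equiv (zc_hom ma mz na nz) (zc_hom ma' mz na' nz').
Proof.
move=> d0 ma'E na'E nz'E; have [phi Aphi pphi] := @aut_exists d e j d0.
apply: rst_step; split; [exact: zc_hom_rb | exact: zc_hom_rb | left; exists phi
  => //].
rewrite (rb_conj_zc_hom _ _ _ _ Aphi pphi) /= -ma'E -na'E -nz'E !addrK.
by rewrite ![(d * _)%R]mulrC !mulfK.
Qed.

Lemma zc_hom_canonical ma mz na nz : exists2 i, admissible p i &
  rb_equiv (zc_hom ma mz na nz) (frakB_hom i).
Proof.
have leF (x : F) : x <= p - 1 by rewrite subn1 -ltnS prednK ?prime_gt0 ?Fp_lt.
have [mz0|mz0] := eqVneq mz 0%R; last first.
  (* The value of [y] is forced by the invariant [ma nz - mz na], which is [- l y] for [RB4]; [e]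
     then equalises [ma] and [mz], and [j] adjusts [na]. *)
  exists (RB4 mz (na - ma * nz / mz)%R).
    by rewrite /admissible !leF !andbT Fp_gt0.
  rewrite /frakB_hom.
  rewrite !natr_Zp; set B : F := _%:R%R; set e : F := (1 - ma / mz)%R.
  apply: (@zc_hom_equiv 1%R e ((na + e * nz - B) / mz)%R).
  - exact: oner_neq0.
  - by rewrite /e; field.
  - by field.
  - by rewrite /e; field.
have [ma0|ma0] := eqVneq ma 0%R; last first.
  (* For [RB3] the same invariant is [x]; [d] normalises [ma] to 1. *)
  exists (RB3 (ma * nz)%R); first exact: leF.
  rewrite /frakB_hom.
  rewrite !natr_Zp mz0.
  apply: (@zc_hom_equiv (1 / ma)%R 0%R ((na - ma * nz) / ma)%R).
  - by rewrite div1r invr_eq0.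
  - by field.
  - by field.
  - by field.
have [nz0|nz0] := eqVneq nz 0%R; last first.
  exists RB1 => //=; rewrite ma0 mz0.
  apply: (@zc_hom_equiv nz (1 - na)%R 0%R) => //; by ring.
exists (RB2 na); first exact: leF.
by rewrite /frakB_hom natr_Zp ma0 mz0 nz0; apply: rst_refl.
Qed.

Lemma rb_canonical (B : {ffun gT -> gT}) : rota_baxter B ->
  exists2 i, admissible p i & rb_equiv B (frakB p a b c i).
Proof.
have trivial B' : rota_baxter B' -> B' c = 1 ->
    exists2 i, admissible p i & rb_equiv B' (frakB p a b c i).
  move=> rbB' /(rb_zc_hom rbB')[ma [mz [na [nz ->]]]].
  by have [i ai iE] := zc_hom_canonical ma mz na nz; exists i; rewrite //
    frakBE.
move=> rbB; have [m [Bc /eqP mm _]] := rb_dichotomy rbB.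
move: mm; rewrite mulf_eq0 addr_eq0 => /orP[]/eqP mE.
  by apply: trivial; rewrite // Bc mE.
(* For [m = -1] the tilde operator sends [c] to [c^-1 * c = 1], which is the previous case. *)
have rbB' := rb_tilde_rb rbB.
have [|i ai iE] := trivial _ rbB'; last first.
  exists i => //; apply: rst_trans iE; apply: rst_step; split=> //; by right.
have cN1 : c^-1 = c ^+ (-1 : F)%R.
  by rewrite expFpN // (expFp_nat p_pr 1%N cp).
by rewrite ffunE {2}cN1 rb_cX // Bc mE -expFpM // mulrNN mulr1
  (expFp_nat p_pr 1%N cp) mulVg.
Qed.

(** * Invariants separating the orbits *)

Lemma zc_hom_orbit_inv (phi : {perm gT}) ma mz na nz ma' mz' na' nz' :
  phi \in Aut [set: gT] -> zc_hom ma' mz' na' nz' = rb_conj phi (zc_hom ma mz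
    na nz) ->
  [/\ mz' = mz, (ma' * nz' - mz' * na' = ma * nz - mz * na)%R,
      mz = 0%R -> (ma' == 0%R) = (ma == 0%R),
      ma = 0%R -> mz = 0%R -> (nz' == 0%R) = (nz == 0%R)
    & ma = 0%R -> mz = 0%R -> nz = 0%R -> na' = na].
Proof.
move=> Aphi; have [d [e [j pphi]]] := aut_has_params Aphi.
have d0 : d != 0%R by case: pphi.
rewrite (rb_conj_zc_hom _ _ _ _ Aphi pphi) => /zc_hom_inj[-> -> -> ->]; split=>
  //.
- by field.
- by move=> ->; rewrite mulr0 addr0 mulf_eq0 (negPf d0).
- by move=> _ ->; rewrite mulr0 subr0 mulf_eq0 invr_eq0 (negPf d0) orbF.
- by move=> -> -> ->; field.
Qed.

(** A tilde cannot intervene: the listed operators and their conjugates kill [c], whereas the tilde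
    of such an operator sends [c] to [c^-1]. The conjugation invariants decide the rest. *)
Lemma frakB_orbit_inj i j : admissible p i -> admissible p j ->
  rb_equiv (frakB p a b c i) (frakB p a b c j) -> i = j.
Proof.
move=> ai aj; rewrite !frakBE => /rb_equiv_orbit[phi Aphi].
have T1 k g : acoord g = 0%R -> zcoord g = 0%R -> frakB_hom k g = 1.
  by move=> Ng Kg; case: k => *; rewrite ffunE Ng Kg !mulr0 addr0 mulg1.
case=> [E|/(congr1 (fun f : {ffun gT -> gT} => f c))]; last first.
  have [d [e [j' [_ Nphi Kphi _ _]]]] := aut_has_params Aphi.
  have phi1 : phi 1 = 1 by rewrite -(expg0 1) autX.
  rewrite [rb_tilde _ _]ffunE [rb_conj _ _ _]ffunE !T1 ?acoord_c ?zcoord_c //.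
  - rewrite -{2}phi1 permK mulg1 => /(congr1 (fun g => g^-1)).
    by rewrite invgK invg1 => cE; case/eqP: c1.
  - by rewrite Nphi acoordV acoord_c oppr0 mulr0.
  - by rewrite Kphi acoordV zcoordV acoord_c zcoord_c oppr0 mulr0 addr0.
have ltp n : n <= p - 1 -> n < p.
  by rewrite subn1 -ltnS prednK ?prime_gt0.
have nat0 n : 0 < n <= p - 1 -> (n%:R != 0 :> F)%R.
  case/andP=> n0 /ltp np; apply: contraTneq n0 => nE.
  by rewrite (@Fp_nat_inj n 0 np (prime_gt0 p_pr) nE).
have inj n m : n <= p - 1 -> m <= p - 1 -> (n%:R = m%:R :> F)%R -> n = m.
  by move=> /ltp np /ltp mp; apply: Fp_nat_inj.
case: i ai E => [|x|x|l y] ai; case: j aj => [|x'|x'|l' y'] aj;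
  move/(zc_hom_orbit_inv Aphi) => [mzE dE maP nzP naE] //.
- by move: (nzP erefl erefl); rewrite eqxx oner_eq0.
- by move: (maP erefl); rewrite eqxx oner_eq0.
- by case/andP: aj => /nat0; rewrite mzE eqxx.
- by move: (nzP erefl erefl); rewrite eqxx oner_eq0.
- by congr RB2; apply: inj => //; rewrite naE.
- by move: (maP erefl); rewrite eqxx oner_eq0.
- by case/andP: aj => /nat0; rewrite mzE eqxx.
- by move: (maP erefl); rewrite eqxx oner_eq0.
- by move: (maP erefl); rewrite eqxx oner_eq0.
- by congr RB3; apply: inj => //; move: dE; rewrite !mul1r !mul0r !subr0 => ->.
- by case/andP: aj => /nat0; rewrite mzE eqxx.
- by case/andP: ai => /nat0; rewrite -mzE eqxx.
- by case/andP: ai => /nat0; rewrite -mzE eqxx.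
- by case/andP: ai => /nat0; rewrite -mzE eqxx.
(* Here [mz] gives [l], and the invariant [- l y] then gives [y]. *)
- move: (ai) (aj) => /andP[l0 y0] /andP[l0' y0'].
  have ll : l' = l by apply: inj => //; [case/andP: l0' | case/andP: l0].
  congr RB4 => //; apply: inj => //; apply: (mulfI (nat0 _ l0)).
  have E (u v w w' : F) : (u * (v - w') - u * v = u * (v - w) - u * v ->
      u * w = u * w')%R.
    by rewrite !mulrBr ![(u * v - _)%R]addrC !addrK => /oppr_inj.
  by move: dE; rewrite ll; apply: E.
Qed.

End NormalForm.

End Coordinates.

(** * Verification of the coordinate hypotheses for [z = b^-1 a], and conclusion *)

Theorem theorem2 (p : nat) (gT : finGroupType) (a b c : gT) :
  prime p -> odd p -> is_E3 p a b c ->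
  [/\ (forall i : rb_index, admissible p i -> rota_baxter (frakB p a b c i)),
      (forall B : {ffun gT -> gT}, rota_baxter B ->
         exists2 i : rb_index, admissible p i & rb_equiv B (frakB p a b c i))
    & (forall i j : rb_index, admissible p i -> admissible p j -> i <> j ->
         ~ rb_equiv (frakB p a b c i) (frakB p a b c j))].
Proof.
move=> p_pr p_odd E3; have c1 := E3_c_neq1 p_pr p_odd E3.
case: E3 => _ genG abc [ap bp] [ac bc cp].
have cC g : commute c g.
  have : c \in 'C(<<[set a; b; c]>>).
    rewrite cent_gen; apply/centP=> u; rewrite !inE.
    by move=> /orP[/orP[]|] /eqP -> //; apply/commute_sym/commgP/eqP.
  by rewrite genG => /centP; apply; rewrite inE.
have cJ g : c ^ g = c by rewrite conjgE cC mulKg.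
have abV : [~ a, b^-1] = c^-1.
  apply: (mulIg (c ^ b^-1)); rewrite -{1}abc -commgMJ mulgV commg1.
  by rewrite cJ mulVg.
have zp : (b^-1 * a) ^+ p = 1.
  rewrite expMg_Rmul ?abV; try by
    apply/commute_sym/commute_sym/commuteV/commute_sym/cC.
  by rewrite bin2odd // expgM !expgVn ap bp cp ?invg1 ?expg1n invg1 mulg1 mulVg.
have cza : [~ b^-1 * a, a] = c.
  by rewrite commMgJ commgg mulg1 -[[~ b^-1, a]]invgK invg_comm abV invgK cJ.
have gen : <<[set a; b^-1 * a]>> = [set: gT].
  apply/eqP; rewrite eqEsubset subsetT -genG gen_subG.
  have Ha : a \in <<[set a; b^-1 * a]>> by rewrite mem_gen ?set21.
  have Hb : b \in <<[set a; b^-1 * a]>>.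
    have bE : a * (b^-1 * a)^-1 = b by rewrite invMg invgK mulKVg.
    by rewrite -{1}bE groupM // groupV mem_gen ?set22.
  apply/subsetP=> u; rewrite !inE => /orP[/orP[]|] /eqP -> //.
  by rewrite -abc groupR.
split=> [i _|B rbB|i j ai aj ij eqv].
- rewrite (frakBE p_pr p_odd c1 cp zp ap cza cC gen erefl).
  by case: i => *; apply: (zc_hom_rb p_pr p_odd c1 cp zp ap cza cC gen).
- exact: (rb_canonical p_pr p_odd c1 cp zp ap cza cC gen erefl).
by apply: ij; apply: (frakB_orbit_inj p_pr p_odd c1 cp zp ap cza cC gen erefl).
Qed.
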